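(* Let $X$ be a separable metric space, $\mu$ a Borel probability measure on $X$ and $T:X\to X$ a measurable map preserving $\mu$. Suppose $(X,T,\mu)$ has superpolynomial decay of correlations. Let $x_0\in X$ be a point at which the local dimension $d_\mu(x_0)=\lim_{r\to 0}\frac{\log \mu(B(x_0,r))}{\log r}$ exists. Then $$\overline{R}(x,x_0)=\underline{R}(x,x_0)=d_\mu(x_0)$$ for $\mu$-almost every $x\in X$.
   Context: $B(x_0,r)$ denotes the ball with center $x_0$ and radius $r$. Hitting time: $\tau_r(x,x_0)=\min\{n\in\mathbb{N}: n>0,\ T^n(x)\in B(x_0,r)\}$. Hitting time indicators: $$\overline{R}(x,x_0)=\limsup_{r\to 0}\frac{\log \tau_r(x,x_0)}{-\log r},\qquad \underline{R}(x,x_0)=\liminf_{r\to 0}\frac{\log \tau_r(x,x_0)}{-\log r}.$$ If for some $r>0$ the time $\tau_r(x,x_0)$ is not defined (the orbit never enters $B(x_0,r)$), then $\overline{R}(x,x_0)$ and $\underline{R}(x,x_0)$ are both set equal to $+\infty$. Superpolynomial decay of correlations: there is a function $\Phi:\mathbb{N}\to[0,\infty)$ with $\lim_{n\to\infty} n^{\alpha}\Phi(n)=0$ for all $\alpha>0$ such that for all Lipschitz observables $\phi,\psi:X\to\mathbb{R}$ (of finite Lipschitz norm) and all $n\ge 1$, $$\left|\int \phi\circ T^n\,\psi\,d\mu-\int\phi\,d\mu\int\psi\,d\mu\right|\le \|\phi\|\,\|\psi\|\,\Phi(n),$$ where $\|\phi\|=\sup|\phi|+\mathrm{Lip}(\phi)$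 is the Lipschitz norm, $\mathrm{Lip}(\phi)$ being the least Lipschitz constant. *)

(* Defs.v *)
From HB Require Import structures.
From mathcomp Require Import all_boot all_order all_algebra.
From mathcomp Require Import all_classical all_reals all_analysis.

Set Implicit Arguments.
Unset Strict Implicit.
Unset Printing Implicit Defensive.

Import Order.TTheory GRing.Theory Num.Theory.
Import numFieldNormedType.Exports.

Local Open Scope classical_set_scope.
Local Open Scope ring_scope.

(* [Measurable] includes [Pointed], so a [borelMetricType] is nonempty. *)
HB.mixin Record isBorel (d : measure_display) (R : realType) X
    & Metric R X & Measurable d X := {
  measurable_borel : @measurable d X = <<s @open X >>
}.

#[short(type="borelMetricType")]
HB.structure Definition BorelMetric (d : measure_display) (R : realType) :=
  { X of Metric R X & Measurable d X & isBorel d R X }.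

Definition separable_space (X : topologicalType) : Prop :=
  exists2 D : set X, countable D & dense D.

Section lipschitz_norm.
Context {R : realType} {X : metricType R}.
Implicit Type phi : X -> R.

(* The condition [0 <= k] matters only when X has a single point. *)
Definition lipschitz_constants phi : set R :=
  [set k | 0 <= k /\ forall x y, `|phi x - phi y| <= k * mdist x y].

Definition abs_values phi : set R := range (fun x => `|phi x|).

Definition finite_lipschitz_norm phi : Prop :=
  has_ubound (abs_values phi) /\ lipschitz_constants phi !=set0.

(* Junk value unless [finite_lipschitz_norm phi]. *)
Definition lipschitz_norm phi : R :=
  sup (abs_values phi) + inf (lipschitz_constants phi).

End lipschitz_norm.

Section dynamics.
Context {d : measure_display} {R : realType} {X : borelMetricType d R}.
Implicit Types (mu : probability X R) (T : X -> X) (x : X).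

Definition preserves mu T : Prop :=
  forall A : set X, measurable A -> mu (T @^-1` A) = mu A.

Definition superpolynomial_decay mu T : Prop :=
  exists Phi : nat -> R,
    [/\ forall n, 0 <= Phi n,
        forall alpha : R, 0 < alpha ->
          n%:R `^ alpha * Phi n @[n --> \oo] --> 0
      & forall phi psi : X -> R,
          finite_lipschitz_norm phi -> finite_lipschitz_norm psi ->
          forall n, (1 <= n)%N ->
          `| \int[mu]_x (phi (iter n T x) * psi x)
             - (\int[mu]_x phi x) * (\int[mu]_x psi x) |
          <= lipschitz_norm phi * lipschitz_norm psi * Phi n].

Definition hits T x x0 (r : R) : pred nat :=
  fun n => (0 < n)%N && `[< ball x0 r (iter n T x) >].

(* [None] when the orbit of x never enters the ball. *)
Definition hitting_time T x x0 (r : R) : option nat :=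
  if pselect (exists n, hits T x x0 r n) is left ex then Some (ex_minn ex)
  else None.

Definition hitting_undefined T x x0 : Prop :=
  exists2 r : R, 0 < r & hitting_time T x x0 r = None.

Definition hitting_exponent T x x0 (r : R) : \bar R :=
  (ln (odflt 0%N (hitting_time T x x0 r))%:R / - ln r)%:E.

Definition upper_hitting_indicator T x x0 : \bar R :=
  if pselect (hitting_undefined T x x0) then +oo%E
  else limf_esup (hitting_exponent T x x0) 0^'+.

Definition lower_hitting_indicator T x x0 : \bar R :=
  if pselect (hitting_undefined T x x0) then +oo%E
  else limf_einf (hitting_exponent T x x0) 0^'+.

(* Since [lne 0 = -oo], this is [+oo] at r < 1 when the ball is null. *)
Definition dimension_quotient mu x0 (r : R) : \bar R :=
  (lne (mu (ball x0 r)) * ((ln r)^-1)%:E)%E.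

(* Limits are taken in [\bar R]: a local dimension equal to [+oo] exists. *)
Definition has_local_dimension mu x0 : Prop :=
  cvg (dimension_quotient mu x0 r @[r --> 0^'+]).

Definition local_dimension mu x0 : \bar R :=
  lim (dimension_quotient mu x0 r @[r --> 0^'+]).

End dynamics.

(* Main.v *)
(* Work along the radii r = e^{-n} and write B_r for the ball at x0.
   Lower bound: by invariance, the set of points hitting B_r before time
   r^{-c} has measure at most r^{-c} mu(B_r), which is summable in n when
   c < d_mu(x0).
   Upper bound: let c > d_mu(x0) and let f be a Lipschitz bump supported in
   B_r. Sample the orbit at the multiples of a gap g = r^{-s}. Decay of
   correlations makes the samples of f almost uncorrelated: the error, at most
   |f|^2 Phi(g) with |f| of order 1/r, is smaller than any power of r.
   Chebyshev's inequality then bounds the measure of the set of points missing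
   B_r up to time r^{-c} by a constant times r^s, again summable.
   Borel-Cantelli, monotonicity in r between consecutive radii and a countable
   family of exponents c conclude. *)
Require Import Defs.
From mathcomp Require Import all_boot all_order all_algebra.
From mathcomp Require Import all_classical all_reals all_analysis.
From mathcomp Require Import measurable_realfun ring lra.

Import Order.TTheory GRing.Theory Num.Theory.
Import numFieldNormedType.Exports.

Local Open Scope classical_set_scope.
Local Open Scope ring_scope.
Local Set Implicit Arguments.
Local Unset Strict Implicit.

(** * Integration of bounded measurable functions and a second moment bound *)

Section bounded_integration.
Context {d : measure_display} {X : measurableType d} {R : realType}.
Variable mu : probability X R.
Implicit Types f g : X -> R.

(** Unlike integrability, boundedness is stable under products, as second moments require; over a
    probability it implies integrability. *)
Definition bounded_mfun f :=
  measurable_fun [set: X] f /\ exists B : R, forall x, `|f x| <= B.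

Lemma bounded_mfun_integrable f :
  bounded_mfun f -> mu.-integrable [set: X] (EFin \o f).
Proof.
move=> [mf [B fB]]; apply: measurable_bounded_integrable => //.
  by apply: le_lt_trans (probability_le1 mu measurableT) _; rewrite ltry.
exists B; split; first exact: num_real.
by move=> y By x _; exact: le_trans (fB x) (ltW By).
Qed.

Lemma bounded_mfun_cst (c : R) : bounded_mfun (cst c).
Proof. by split; [exact: measurable_cst|exists `|c|]. Qed.

Lemma bounded_mfun_indic (A : set X) : measurable A -> bounded_mfun \1_A.
Proof.
move=> mA; split; first exact: measurable_indic.
by exists 1 => x; rewrite indicE; case: (_ \in _); rewrite ?normr1 ?normr0.
Qed.

Lemma bounded_mfunD f g :
  bounded_mfun f -> bounded_mfun g -> bounded_mfun (fun x => f x + g x).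
Proof.
move=> [mf [B fB]] [mg [C gC]]; split; first exact: measurable_funD.
by exists (B + C) => x; rewrite (le_trans (ler_normD _ _))// lerD.
Qed.

Lemma bounded_mfunM f g :
  bounded_mfun f -> bounded_mfun g -> bounded_mfun (fun x => f x * g x).
Proof.
move=> [mf [B fB]] [mg [C gC]]; split; first exact: measurable_funM.
by exists (B * C) => x; rewrite normrM ler_pM.
Qed.

Lemma bounded_mfun_sum (I : Type) (s : seq I) (F : I -> X -> R) :
  (forall i, bounded_mfun (F i)) -> bounded_mfun (fun x => \sum_(i <- s) F i x).
Proof.
move=> bF; elim: s => [|i s ih].
  under eq_fun do rewrite big_nil.
  exact: bounded_mfun_cst.
under eq_fun do rewrite big_cons.
exact: bounded_mfunD.
Qed.

Lemma bounded_mfun_comp f (T : X -> X) :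
  measurable_fun [set: X] T -> bounded_mfun f -> bounded_mfun (f \o T).
Proof.
move=> mT [mf [B fB]]; split; first exact: measurableT_comp.
by exists B => x; exact: fB.
Qed.

Lemma Rintegral_sum (I : Type) (s : seq I) (F : I -> X -> R) :
  (forall i, bounded_mfun (F i)) ->
  \int[mu]_x (\sum_(i <- s) F i x) = \sum_(i <- s) \int[mu]_x F i x.
Proof.
move=> bF; elim: s => [|i s ih].
  under eq_Rintegral do rewrite big_nil.
  by rewrite big_nil Rintegral_cst// mul0r.
under eq_Rintegral do rewrite big_cons.
rewrite big_cons RintegralD ?ih//; apply: bounded_mfun_integrable => //.
exact: bounded_mfun_sum.
Qed.

Lemma Rintegral_preserving f (T : X -> X) : measurable_fun [set: X] T ->
  (forall A, measurable A -> mu (T @^-1` A) = mu A) -> bounded_mfun f ->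
  \int[mu]_x f (T x) = \int[mu]_x f x.
Proof.
move=> mT muT bf; rewrite /Rintegral; congr fine.
have := @integral_pushforward _ _ _ _ _ _ mT mu [set: X] (EFin \o f).
rewrite preimage_setT => <-//; first last.
- exact/bounded_mfun_integrable/bounded_mfun_comp.
- by apply/measurable_EFinP; case: bf.
apply: eq_measure_integral => A mA _.
exact: muT.
Qed.

(* Integrates [\1_A * (M m)^2 <= (S - M m)^2], where S is the sum of the Y i. *)
Lemma second_moment (M : nat) (Y : nat -> X -> R) (m e : R) (A : set X) :
  measurable A -> (forall i x, (i < M)%N -> A x -> Y i x = 0) ->
  (forall i, bounded_mfun (Y i)) -> (forall i, \int[mu]_x Y i x = m) ->
  (forall i, \int[mu]_x (Y i x * Y i x) <= m) ->
  (forall i j, i != j -> \int[mu]_x (Y i x * Y j x) <= m ^+ 2 + e) ->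
  0 <= e ->
  fine (mu A) * (M%:R * m) ^+ 2 <= M%:R * m + M%:R ^+ 2 * e.
Proof.
move=> mA A0 bY intY intYY intYiYj e0.
pose S x := \sum_(i < M) Y i x; pose c := M%:R * m.
have bS : bounded_mfun S by exact: bounded_mfun_sum.
have intS : \int[mu]_x S x = c.
  rewrite Rintegral_sum//; under eq_bigr do rewrite intY.
  by rewrite sumr_const card_ord -mulr_natl.
have bSS : bounded_mfun (fun x => S x * S x) by exact: bounded_mfunM.
have intSS : \int[mu]_x (S x * S x) <= M%:R * m + M%:R ^+ 2 * (m ^+ 2 + e).
  have -> : \int[mu]_x (S x * S x) =
      \sum_(i < M) \sum_(j < M) \int[mu]_x (Y i x * Y j x).
    under eq_Rintegral do rewrite /S mulr_suml.
    rewrite Rintegral_sum => [|i]; last exact/bounded_mfunM.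
    apply: eq_bigr => i _.
    under eq_Rintegral do rewrite mulr_sumr.
    by rewrite Rintegral_sum => // j; exact/bounded_mfunM.
  (* The bound is spread over the pairs (i, j), the diagonal carrying an extra [m], so that the
     comparison becomes termwise. *)
  have -> : M%:R * m + M%:R ^+ 2 * (m ^+ 2 + e) =
      \sum_(i < M) \sum_(j < M) (m *+ (i == j) + (m ^+ 2 + e)).
    under eq_bigr => i _.
      rewrite big_split/= sumr_const card_ord.
      rewrite (bigD1 i)//= eqxx big1 ?addr0; last first.
        by move=> j /negbTE; rewrite eq_sym => ->.
      over.
    rewrite /= mulr1n sumr_const card_ord -(mulr_natl (_ + _)).
    by rewrite -(mulr_natl (m ^+ 2 + e)); ring.
  apply: ler_sum => i _; apply: ler_sum => j _.
  have [->|ij] := eqVneq i j.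
    by rewrite (le_trans (intYY j))// lerDl addr_ge0// sqr_ge0.
  by rewrite add0r intYiYj.
have : \int[mu]_x (\1_A x * c ^+ 2) <=
    \int[mu]_x (S x * S x + (- (2 * c) * S x + c ^+ 2)).
  apply: le_Rintegral => //.
  - apply: bounded_mfun_integrable; apply: bounded_mfunM; last exact: bounded_mfun_cst.
    exact: bounded_mfun_indic.
  - apply: bounded_mfun_integrable; apply: bounded_mfunD => //.
    apply: bounded_mfunD; last exact: bounded_mfun_cst.
    by apply: bounded_mfunM => //; exact: bounded_mfun_cst.
  move=> x _; rewrite indicE; case: (boolP (x \in A)) => [|_].
    rewrite inE => Ax; have -> : S x = 0 by rewrite /S big1// => i _; exact: A0.
    by rewrite !mulr0 mul1r !add0r.
  rewrite mul0r (_ : _ + _ = (S x - c) ^+ 2) ?sqr_ge0//.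
  by ring.
rewrite RintegralZr//; last exact/bounded_mfun_integrable/bounded_mfun_indic.
have -> : \int[mu]_x \1_A x = fine (mu A).
  by rewrite /Rintegral integral_indic// setIT.
rewrite RintegralD//; last 2 first.
- exact: bounded_mfun_integrable.
- apply: bounded_mfun_integrable; apply: bounded_mfunD; last exact: bounded_mfun_cst.
  by apply: bounded_mfunM => //; exact: bounded_mfun_cst.
rewrite RintegralD//; last 2 first.
- apply: bounded_mfun_integrable.
  by apply: bounded_mfunM => //; exact: bounded_mfun_cst.
- exact/bounded_mfun_integrable/bounded_mfun_cst.
rewrite RintegralZl//; last exact: bounded_mfun_integrable.
have -> : \int[mu]__ c ^+ 2 = c ^+ 2.
  by rewrite Rintegral_cst// [X in fine X](probability_setT mu) mulr1.
rewrite intS => H.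
apply: le_trans H _.
have -> : M%:R * m + M%:R ^+ 2 * e =
   M%:R * m + M%:R ^+ 2 * (m ^+ 2 + e) + (- (2 * c) * c + c ^+ 2).
  by rewrite /c; ring.
by rewrite lerD2r.
Qed.

End bounded_integration.

(** * Balls, iterates of the map and the Lipschitz bump *)

Section dynamics.
Context {d : measure_display} {R : realType} {X : borelMetricType d R}.
Variable (mu : probability X R) (T : X -> X) (x0 : X).
Hypotheses (mT : measurable_fun [set: X] T) (muT : preserves mu T).

Lemma open_measurable_borel (A : set X) : open A -> measurable A.
Proof. by move=> oA; rewrite measurable_borel; exact: sub_sigma_algebra. Qed.

Lemma open_mball (x : X) (r : R) : open (ball x r).
Proof.
rewrite openE => y; rewrite ballEmdist/= => xyr; apply/nbhs_ballP.
exists (r - mdist x y); first by rewrite /= subr_gt0.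
move=> z; rewrite !ballEmdist/= => yz.
by rewrite (le_lt_trans (metric_triangle x y z))// -ltrBrDl.
Qed.

Lemma measurable_mball (x : X) (r : R) : measurable (ball x r).
Proof. exact/open_measurable_borel/open_mball. Qed.

Lemma measurable_mdist (x : X) : measurable_fun [set: X] (mdist x).
Proof.
(* Open rays unbounded below generate the Borel sets of the line, and their preimages are balls. *)
apply: (measurability _ (RGenInftyO.measurableE R)) => /= _ [_ [y ->]] <-.
rewrite setTI (_ : _ @^-1` _ = ball x y); first exact: measurable_mball.
by rewrite ballEmdist; apply/seteqP; split => z /=; rewrite in_itv.
Qed.

Lemma measurable_iter n : measurable_fun [set: X] (iter n T).
Proof.
elim: n => [|n ih]; first exact: measurable_id.
exact: (measurableT_comp mT ih).
Qed.

Lemma preserves_iter n A : measurable A -> mu (iter n T @^-1` A) = mu A.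
Proof.
move=> mA; elim: n => // n ih.
rewrite -ih (_ : iter n.+1 T @^-1` A = T @^-1` (iter n T @^-1` A)).
  by apply: muT; rewrite -[X in measurable X]setTI; exact: measurable_iter.
by apply/seteqP; split => x; rewrite /preimage /= -iterSr.
Qed.

Lemma measurable_hit n r : measurable (iter n T @^-1` ball x0 r).
Proof.
by rewrite -[X in measurable X]setTI; apply: measurable_iter => //; exact: measurable_mball.
Qed.

(** A tent of height 1 and slope [r^-1]: a Lipschitz substitute for the indicator of the ball, to
    which decay of correlations applies. *)
Definition bump (r : R) (x : X) : R := Num.max 0 (1 - mdist x0 x / r).

Section bump.
Variable r : R.
Hypothesis r0 : 0 < r.

Lemma bump_ge0 x : 0 <= bump r x.
Proof. by rewrite le_max lexx. Qed.

Lemma bump_le1 x : bump r x <= 1.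
Proof.
by rewrite ge_max ler01 gerBl divr_ge0 ?mdist_ge0 ?ltW.
Qed.

Lemma bump_notin_ball x : ~ ball x0 r x -> bump r x = 0.
Proof.
rewrite ballEmdist/= => /negP; rewrite -leNgt => rx.
by apply/max_idPl; rewrite subr_le0 ler_pdivlMr// mul1r.
Qed.

Lemma bump_ge_half x : ball x0 (r / 2) x -> 2^-1 <= bump r x.
Proof.
rewrite ballEmdist/= => xr; rewrite le_max; apply/orP; right.
rewrite lerBrDr -lerBrDl ler_pdivrMr//.
by rewrite (le_trans (ltW xr))//; lra.
Qed.

Lemma bump_lipschitz : lipschitz_constants (bump r) r^-1.
Proof.
split; first by rewrite invr_ge0 ltW.
(* One side suffices, since the distance is symmetric. *)
have half x y : bump r x - bump r y <= r^-1 * mdist x y.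
  rewrite lerBlDr ge_max; apply/andP; split.
    by rewrite addr_ge0 ?bump_ge0// mulr_ge0 ?mdist_ge0// invr_ge0 ltW.
  have : 1 - mdist x0 y / r <= bump r y by rewrite le_max lexx orbT.
  have : mdist x0 y / r <= (mdist x0 x + mdist x y) / r.
    by rewrite ler_pM2r ?invr_gt0// metric_triangle.
  rewrite mulrDl [_ * mdist x y]mulrC; lra.
move=> x y; rewrite ler_norml half andbT lerNl opprB.
by rewrite metric_sym half.
Qed.

Lemma bump_abs_values_ubound : ubound (abs_values (bump r)) 1.
Proof. by move=> _ [x _ <-]; rewrite ger0_norm ?bump_ge0 ?bump_le1. Qed.

Lemma bump_finite_lipschitz_norm : finite_lipschitz_norm (bump r).
Proof.
split; first by exists 1; exact: bump_abs_values_ubound.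
by exists r^-1; exact: bump_lipschitz.
Qed.

Lemma bump_lipschitz_norm_ge0 : 0 <= lipschitz_norm (bump r).
Proof.
apply: addr_ge0.
  have [ub _] := bump_finite_lipschitz_norm.
  apply: (@le_trans _ _ `|bump r x0|) => //.
  by apply: ub_le_sup => //; exact: imageT.
apply: lb_le_inf; first by exists r^-1; exact: bump_lipschitz.
by move=> k [].
Qed.

Lemma bump_lipschitz_norm_le : lipschitz_norm (bump r) <= 1 + r^-1.
Proof.
apply: lerD.
  apply: ge_sup; last exact: bump_abs_values_ubound.
  by exists `|bump r x0|; exact: imageT.
apply: ge_inf; last exact: bump_lipschitz.
by exists 0 => k [].
Qed.

Lemma bump_bounded_mfun : bounded_mfun (bump r).
Proof.
split; last first.
  by exists 1 => x; rewrite ger0_norm ?bump_ge0 ?bump_le1.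
apply: measurable_maxr; first exact: measurable_cst.
apply: measurable_funB; first exact: measurable_cst.
by apply: measurable_funM; [exact: measurable_mdist|exact: measurable_cst].
Qed.

(** The bump is at least 1/2 on the ball of half the radius and nonnegative elsewhere. *)
Lemma Rintegral_bump_ge :
  2^-1 * fine (mu (ball x0 (r / 2))) <= \int[mu]_x bump r x.
Proof.
have mB := measurable_mball x0 (r / 2).
have -> : fine (mu (ball x0 (r / 2))) = \int[mu]_x \1_(ball x0 (r / 2)) x.
  by rewrite /Rintegral integral_indic// setIT.
have bI := bounded_mfun_indic mB.
rewrite -RintegralZl//; last exact: bounded_mfun_integrable.
apply: le_Rintegral => //.
- apply/bounded_mfun_integrable/bounded_mfunM => //; exact: bounded_mfun_cst.
- exact/bounded_mfun_integrable/bump_bounded_mfun.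
move=> x _; rewrite indicE; case: (boolP (x \in _)) => [|_].
  by rewrite inE mulr1; exact: bump_ge_half.
by rewrite mulr0 bump_ge0.
Qed.

End bump.

(** This is [second_moment] for the bump sampled at times g, 2g, ..., Mg. All samples vanish on [A],
    and the decay controls the covariance of two samples through their time difference. *)
Lemma no_hit_bound (Phi : nat -> R) (r p : R) (M g : nat)
    (m := \int[mu]_x bump r x) :
  (forall phi psi : X -> R,
     finite_lipschitz_norm phi -> finite_lipschitz_norm psi ->
     forall n, (1 <= n)%N ->
       `| \int[mu]_x (phi (iter n T x) * psi x)
          - (\int[mu]_x phi x) * (\int[mu]_x psi x) |
       <= lipschitz_norm phi * lipschitz_norm psi * Phi n) ->
  0 < r -> 0 <= p -> (0 < g)%N -> (forall k, (g <= k)%N -> 0 <= Phi k <= p) ->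
  forall A : set X, measurable A ->
  (forall x k, A x -> (0 < k <= M * g)%N -> ~ ball x0 r (iter k T x)) ->
  fine (mu A) * (M%:R * m) ^+ 2 <=
    M%:R * m + M%:R ^+ 2 * ((1 + r^-1) ^+ 2 * p).
Proof.
move=> decay r0 p0 g0 Phip A mA A0.
have bB := bump_bounded_mfun r0.
(* Distinct indices give times at least g apart. *)
pose Y i := bump r \o iter (i.+1 * g) T.
have bY i : bounded_mfun (Y i).
  by apply: bounded_mfun_comp => //; exact: measurable_iter.
have inv f n : bounded_mfun f -> \int[mu]_x f (iter n T x) = \int[mu]_x f x.
  move=> bf; apply: Rintegral_preserving => //; first exact: measurable_iter.
  by move=> B mB; exact: preserves_iter.
have cov i j : (i < j)%N ->
    \int[mu]_x (Y i x * Y j x) <= m ^+ 2 + (1 + r^-1) ^+ 2 * p.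
  move=> ij; pose n := ((j - i) * g)%N.
  have gn : (g <= n)%N by rewrite leq_pmull// subn_gt0.
  (* Invariance moves the earlier sample to time 0. *)
  have -> : \int[mu]_x (Y i x * Y j x) =
      \int[mu]_x (bump r (iter n T x) * bump r x).
    rewrite -(inv (fun x => bump r (iter n T x) * bump r x) (i.+1 * g)%N).
      apply: eq_Rintegral => x _; rewrite /Y /= mulrC -iterD /n -mulnDl.
      by rewrite addnS subnK// ltnW.
    apply: bounded_mfunM => //.
    by apply: bounded_mfun_comp => //; exact: measurable_iter.
  have fB := bump_finite_lipschitz_norm r0.
  have := decay _ _ fB fB n (leq_trans g0 gn).
  move=> /(le_trans (ler_norm _)); rewrite lerBlDl => /le_trans; apply.
  rewrite -expr2 lerD2l -expr2.
  have /andP[Pn0 Pnp] := Phip _ gn.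
  rewrite ler_pM ?sqr_ge0// ler_sqr ?nnegrE ?bump_lipschitz_norm_ge0//.
    exact: bump_lipschitz_norm_le.
  by rewrite addr_ge0// invr_ge0 ltW.
apply: (second_moment mA _ bY) => //.
- move=> i x iM Ax; apply: bump_notin_ball => //; apply: A0 => //.
  by rewrite muln_gt0 g0 leq_mul2r iM orbT.
- by move=> i; exact: inv.
(* The bump takes values in [0, 1], so its square is at most itself. *)
- move=> i; rewrite -[leRHS](inv _ (i.+1 * g)%N)//; apply: le_Rintegral => //.
  + exact/bounded_mfun_integrable/bounded_mfunM.
  + exact: (bounded_mfun_integrable mu (bY i)).
  by move=> x _; rewrite /Y/= ler_piMr ?bump_ge0 ?bump_le1.
- move=> i j; rewrite neq_lt => /orP[|] ij; first exact: cov.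
  by under eq_Rintegral do rewrite mulrC; exact: cov.
- by rewrite mulr_ge0// sqr_ge0.
Qed.

End dynamics.

(** * Borel-Cantelli and hitting estimates along the radii [expR (- n%:R)] *)

Lemma borel_cantelli_expR {d : measure_display} {X : measurableType d}
    {R : realType} (mu : probability X R) (F : nat -> set X) (C s : R) (N : nat) :
  (forall n, measurable (F n)) -> 0 <= C -> 0 < s ->
  (forall n, (N <= n)%N -> fine (mu (F n)) <= C * expR (- (s * n%:R))) ->
  {ae mu, forall x, exists K, forall n, (K <= n)%N -> ~ F n x}.
Proof.
move=> mF C0 s0 FC.
(* The bound starts at [N] only; after the shift, a geometric series of ratio [expR (- s)] dominates
   the measures. *)
pose G n := F (n + N)%N.
have mG n : measurable (G n) by exact: mF.
have Glim : mu (lim_sup_set G) = 0%E.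
  apply: lim_sup_set_cvg0 => //.
  apply: (@le_lt_trans _ _ (C * (1 - expR (- s))^-1)%:E); last exact: ltry.
  apply: lime_le; first exact: is_cvg_nneseries.
  apply: nearW => n.
  apply: (@le_trans _ _ (\sum_(0 <= k < n) (geometric C (expR (- s)) k)%:E)%E).
    apply: lee_sum => k _; rewrite -[leLHS]fineK ?fin_num_measure// lee_fin.
    apply: (le_trans (FC _ (leq_addl _ _))).
    rewrite /geometric/= ler_wpM2l// -expRM_natl ler_expR mulrN lerN2 mulrC.
    by rewrite ler_pM2l// ler_nat leq_addr.
  rewrite sumEFin lee_fin geometric_le_lim ?expR_gt0//.
  by rewrite gtr0_norm ?expR_gt0// expR_lt1 oppr_lt0.
exists (lim_sup_set G); split => //.
  by apply: bigcap_measurable => // k _; exact: bigcup_measurable.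
move=> x /= H k _; apply: contrapT => nG; apply: H.
exists (k + N)%N => n kn Fnx; apply: nG; exists (n - N)%N => /=.
  by rewrite leq_subRL ?(leq_trans (leq_addl _ _) kn)// addnC.
by rewrite /G subnK// (leq_trans (leq_addl _ _) kn).
Qed.

Section asymptotics.
Context {d : measure_display} {R : realType} {X : borelMetricType d R}.
Variables (mu : probability X R) (T : X -> X) (x0 : X).
Hypotheses (mT : measurable_fun [set: X] T) (muT : preserves mu T).

(** The index k stands for time k + 1, because time 0 does not count as a hit. *)
Definition hit_within (r : R) (N : nat) : set X :=
  \big[setU/set0]_(k < N) (iter k.+1 T @^-1` ball x0 r).

Lemma hit_withinP r N x :
  hit_within r N x <-> exists2 k, (0 < k <= N)%N & ball x0 r (iter k T x).
Proof.
rewrite /hit_within -(bigcup_mkord N (fun k => iter k.+1 T @^-1` ball x0 r)).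
split => [[k /= kN kx]|[[//|k] kN kx]].
  by exists k.+1.
by exists k.
Qed.

Lemma measurable_hit_within r N : measurable (hit_within r N).
Proof. by apply: bigsetU_measurable => k _; exact: measurable_hit. Qed.

(** Union bound: by invariance each of the N preimages has the measure of the ball. *)
Lemma hit_within_measure_le r N :
  fine (mu (hit_within r N)) <= N%:R * fine (mu (ball x0 r)).
Proof.
rewrite -lee_fin EFinM !fineK ?fin_num_measure//; last 2 first.
- exact: measurable_mball.
- exact: measurable_hit_within.
apply: (@le_trans _ _ (\sum_(k < N) mu (iter k.+1 T @^-1` ball x0 r))%E).
  apply: (@Boole_inequality _ _ _ mu (fun k => iter k.+1 T @^-1` ball x0 r)).
  by move=> k _; exact: measurable_hit.
rewrite (eq_bigr (fun=> mu (ball x0 r))) => [|k _]; last first.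
  by apply: preserves_iter => //; exact: measurable_mball.
by rewrite sumr_const card_ord mule_natl.
Qed.

(** At most [expR (c * n%:R)] times, each of probability at most [expR (- (c' * n%:R))], leave a
    summable bound of rate [c' - c]. *)
Lemma ae_no_early_hit (c c' : R) (N : nat) : c < c' ->
  (forall n, (N <= n)%N ->
    fine (mu (ball x0 (expR (- n%:R)))) <= expR (- (c' * n%:R))) ->
  {ae mu, forall x, exists K, forall n, (K <= n)%N ->
    ~ hit_within (expR (- n%:R)) (Num.trunc (expR (c * n%:R))) x}.
Proof.
move=> cc' small.
apply: (@borel_cantelli_expR _ _ _ _ _ 1 (c' - c) N) => //.
- by move=> n; exact: measurable_hit_within.
- by rewrite subr_gt0.
move=> n Nn; apply: (le_trans (hit_within_measure_le _ _)).
rewrite mul1r (_ : - _ = c * n%:R + - (c' * n%:R)); last by ring.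
rewrite expRD ler_pM// ?fine_ge0// ?truncn_le ?expR_ge0//.
exact: small.
Qed.

(** After division by [(M * m) ^+ 2] the right-hand side is decreasing in [M] and [m], so lower
    bounds may replace them. *)
Lemma chebyshev_ratio (a m q B M M0 : R) :
  0 < q -> q <= m -> 0 < M0 -> M0 <= M -> 0 <= B ->
  a * (M * m) ^+ 2 <= M * m + M ^+ 2 * B ->
  a <= (M0 * q)^-1 + B / q ^+ 2.
Proof.
move=> q0 qm M00 M0M B0 H.
have m0 : 0 < m by exact: lt_le_trans qm.
have M1 : 0 < M by exact: lt_le_trans M0M.
have Mm : 0 < M * m by rewrite mulr_gt0.
apply: (@le_trans _ _ ((M * m)^-1 + B / m ^+ 2)).
  rewrite -(ler_pM2r (exprn_gt0 2 Mm)); apply: (le_trans H).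
  rewrite le_eqVlt; apply/orP; left; apply/eqP.
  by field; rewrite !gt_eqF.
apply: lerD.
  by rewrite lef_pV2 ?posrE ?mulr_gt0// ler_pM// ltW.
rewrite ler_wpM2l// lef_pV2 ?posrE ?exprn_gt0//.
by rewrite ler_sqr// nnegrE ltW.
Qed.

(** The decay is used with exponent [b / s], for which the power of k is at least
    [expR (b * n%:R)]. *)
Lemma superpolynomial_decay_bound (Phi : nat -> R) (s b : R) :
  0 < s -> 0 < b ->
  (forall alpha : R, 0 < alpha -> n%:R `^ alpha * Phi n @[n --> \oo] --> 0) ->
  exists N, forall n, (N <= n)%N -> forall k : nat,
    expR (s * n%:R) <= k%:R -> Phi k <= expR (- (b * n%:R)).
Proof.
move=> s0 b0 lim0.
have alpha0 : 0 < b / s by rewrite divr_gt0.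
have [K _ KP] : \forall n \near \oo, n%:R `^ (b / s) * Phi n < 1.
  by apply: (cvgr_lt 0) => //; exact: lim0.
(* This threshold gives [K%:R <= s * n%:R], hence [K <= k] by the inequality 1 + y <= exp y. *)
exists (Num.trunc (K%:R / s)).+1 => n Nn k sk.
have k0 : 0 < k%:R :> R by apply: lt_le_trans sk; exact: expR_gt0.
have Kk : (K <= k)%N.
  rewrite -(ler_nat R); apply: le_trans sk.
  apply: le_trans (expR_ge1Dx _); rewrite -[leLHS]add0r lerD//.
  rewrite mulrC -ler_pdivrMr//.
  rewrite (le_trans (ltW (truncnS_gt _)))// ler_nat.
  exact: Nn.
have := KP k Kk.
have -> : k%:R `^ (b / s) = expR (b / s * ln k%:R) :> R.
  by rewrite /powR gt_eqF.
rewrite mulrC -ltr_pdivlMr ?expR_gt0// div1r -expRN => /ltW /le_trans; apply.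
rewrite ler_expR lerN2 -mulrA ler_pM2l// ler_pdivlMl//.
by rewrite -(expRK (s * n%:R)) ler_ln ?posrE// expR_gt0.
Qed.

Lemma ae_early_hit (c c' : R) (N : nat) : superpolynomial_decay mu T ->
  0 <= c -> c < c' ->
  (forall n, (N <= n)%N ->
    expR (- (c * n%:R)) <= fine (mu (ball x0 (expR (- n%:R))))) ->
  {ae mu, forall x, exists K, forall n, (K <= n)%N ->
    hit_within (expR (- n%:R)) (Num.trunc (expR (c' * n%:R))) x}.
Proof.
move=> [Phi [Phi0 lim0 decay]] c0 cc' big.
(* The margin is cut in three: one share makes the expected sum of the samples grow like
   [expR (s * n%:R)], one is the gap between samples, and the last absorbs the rounding of both
   numbers. *)
pose s := (c' - c) / 3.
have s0 : 0 < s by rewrite divr_gt0// subr_gt0.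
have c'E : c' = c + 3 * s by rewrite /s; lra.
(* In [B / q ^+ 2] below, [2 c] pays for the square of the mean of the bump,
   [2] for the square of its Lipschitz norm, and s is the gain. *)
pose b := 2 * c + 2 + s.
have b0 : 0 < b by rewrite /b; lra.
have [N1 N1P] := superpolynomial_decay_bound s0 b0 lim0.
pose N2 := (Num.trunc (4 / s)).+1.
(* The summands are what the two terms of [chebyshev_ratio] leave once [expR (- (s * n%:R))] is
   factored out; [expR c] and [expR (2 * c)] come from the index [n.+1] in [q]. *)
pose C := 2 * expR c + 16 * expR (2 * c).
suff : {ae mu, forall x, exists K, forall n, (K <= n)%N ->
    ~ (~` hit_within (expR (- n%:R)) (Num.trunc (expR (c' * n%:R)))) x}.
  apply: filterS => x [K KP]; exists K => n /KP /=; exact: contrapT.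
apply: (@borel_cantelli_expR _ _ _ _ _ C s (maxn N (maxn N1 N2))) => //.
- by move=> n; apply: measurableC; exact: measurable_hit_within.
- by rewrite addr_ge0// mulr_ge0// expR_ge0.
move=> n; rewrite !geq_max => /and3P[Nn N1n N2n].
have sn4 : 4 <= expR (s * n%:R).
  apply: le_trans (expR_ge1Dx _); rewrite -[leLHS]add0r lerD//.
  rewrite mulrC -ler_pdivrMr//.
  by rewrite (le_trans (ltW (truncnS_gt _)))// ler_nat.
pose g := (Num.trunc (expR (s * n%:R))).+1.
pose M := (Num.trunc (expR ((c + s) * n%:R))).+1.
have gge : expR (s * n%:R) <= g%:R by rewrite ltW// truncnS_gt.
have Mge : expR ((c + s) * n%:R) <= M%:R by rewrite ltW// truncnS_gt.
(* Adding 1 to the integer part at most doubles a number that is at least 1. *)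
have trunc2 (y : R) : 0 <= y -> (Num.trunc (expR y)).+1%:R <= 2 * expR y.
  move=> y0; rewrite -natr1 mulrDl mul1r lerD//.
    by rewrite truncn_le expR_ge0.
  by rewrite -expR0 ler_expR.
have Mg : (M * g <= Num.trunc (expR (c' * n%:R)))%N.
  rewrite truncn_ge_nat ?expR_ge0// natrM.
  apply: (@le_trans _ _ (2 * expR ((c + s) * n%:R) * (2 * expR (s * n%:R)))).
    rewrite ler_pM// trunc2// mulr_ge0//; last exact: ltW.
    by rewrite addr_ge0// ltW.
  have -> : expR (c' * n%:R) =
      expR ((c + s) * n%:R) * expR (s * n%:R) * expR (s * n%:R).
    by rewrite -!expRD; congr expR; rewrite c'E; ring.
  rewrite mulrACA mulrC ler_wpM2l//; last lra.
set r := expR (- n%:R); have r0 : 0 < r by exact: expR_gt0.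
pose p := expR (- (b * n%:R)).
pose m := \int[mu]_x bump x0 r x.
(* Since e >= 2, the ball of radius r / 2 contains the one of index [n.+1], whose mass is bounded
   below. *)
pose q := 2^-1 * expR (- (c * n.+1%:R)).
have q0 : 0 < q by rewrite mulr_gt0// expR_gt0.
have qm : q <= m.
  apply: le_trans (Rintegral_bump_ge _ _ r0); rewrite ler_wpM2l//.
  apply: (le_trans (big n.+1 (leqW Nn))).
  rewrite fine_le ?fin_num_measure//; last 3 first.
  - exact: measurable_mball.
  - exact: measurable_mball.
  apply: le_measure; rewrite ?inE; [exact: measurable_mball..|].
  apply: le_ball; rewrite ler_pdivlMr// /r -natr1 opprD expRD -mulrA.
  rewrite ler_piMr ?expR_ge0// expRN ler_pdivrMl ?expR_gt0// mulr1.
  by have := @expR_ge1Dx R 1; lra.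
have /(chebyshev_ratio q0 qm (expR_gt0 _) Mge) : 
  fine (mu (~` hit_within r (Num.trunc (expR (c' * n%:R))))) * (M%:R * m) ^+ 2 <=
    M%:R * m + M%:R ^+ 2 * ((1 + r^-1) ^+ 2 * p).
  apply: (no_hit_bound (M := M) (g := g) mT muT decay r0 (expR_ge0 _)).
  - by [].
  - move=> k gk; rewrite Phi0 N1P//.
    by apply: le_trans gge _; rewrite ler_nat.
  - by apply: measurableC; exact: measurable_hit_within.
  move=> x k nx /andP[k0 kM] kx; apply: nx; apply/hit_withinP.
  by exists k => //; rewrite k0 (leq_trans kM).
have B0 : 0 <= (1 + r^-1) ^+ 2 * p by rewrite mulr_ge0 ?sqr_ge0 ?expR_ge0.
move=> /(_ B0) /le_trans; apply.
rewrite /C [leRHS]mulrDl; apply: lerD.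
  rewrite /q -natr1 le_eqVlt; apply/orP; left; apply/eqP.
  rewrite !invfM invrK -!expRN mulrCA -mulrA; congr (_ * _).
  by rewrite -!expRD; congr expR; ring.
have r1 : (1 + r^-1) ^+ 2 <= 4 * expR (2 * n%:R).
  have -> : expR (2 * n%:R) = expR n%:R ^+ 2 :> R.
    by rewrite expr2 -expRD; congr expR; ring.
  have -> : (4 : R) = 2 ^+ 2 by rewrite -natrX.
  rewrite -exprMn ler_sqr ?nnegrE ?addr_ge0 ?mulr_ge0 ?invr_ge0 ?expR_ge0//.
  rewrite /r expRN invrK mulrDl mul1r lerD2r.
  by rewrite -expR0 ler_expR.
apply: (@le_trans _ _ (4 * expR (2 * n%:R) * p / q ^+ 2)).
  by rewrite ler_wpM2r ?invr_ge0 ?sqr_ge0// ler_wpM2r ?expR_ge0.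
rewrite le_eqVlt; apply/orP; left; apply/eqP.
have -> : (q ^+ 2)^-1 = 4 * expR (2 * (c * n.+1%:R)).
  rewrite /q exprMn invfM -!exprVn invrK -expRN opprK !expr2 -expRD -natrM.
  by congr (_ * expR _); ring.
rewrite /p (_ : _ * _ = 16 * (expR (2 * n%:R) * expR (- (b * n%:R)) *
  expR (2 * (c * n.+1%:R)))); last by ring.
rewrite -[RHS]mulrA; congr (_ * _).
by rewrite -!expRD; congr expR; rewrite /b -natr1; ring.
Qed.

End asymptotics.

(** * Limits at 0 from the right and countable families of almost sure statements *)

Lemma near_right0_ln {R : realType} (A : R) :
  \forall r \near 0^'+, 0 < r /\ A < - ln r.
Proof.
near=> r; have r0 : 0 < r by near: r; exact: nbhs_right_gt.
split=> //; rewrite ltrNr -ltr_expR lnK ?posrE//.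
by near: r; apply: nbhs_right_lt; exact: expR_gt0.
Unshelve. all: by end_near. Qed.

Lemma near_right0_expR {R : realType} (P : R -> Prop) :
  (\forall r \near 0^'+, P r) ->
  exists N, forall n, (N <= n)%N -> P (expR (- n%:R)).
Proof.
move=> [e /= e0 eP]; exists (Num.trunc (- ln e)).+1 => n en.
apply: eP; last exact: expR_gt0.
rewrite /= sub0r normrN gtr0_norm ?expR_gt0//.
rewrite -[ltRHS]lnK ?posrE// ltr_expR ltrNl.
by rewrite (lt_le_trans (truncnS_gt _))// ler_nat.
Qed.

Section limf.
Context {T : choiceType} {X : filteredType T} {R : realType}.
Variables (f : X -> \bar R) (F : set_system X).
Local Open Scope ereal_scope.

Lemma limf_einf_ge (l : \bar R) : (\forall x \near F, l <= f x) ->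
  l <= limf_einf f F.
Proof.
move=> lf; rewrite limf_einfE; apply: le_ereal_sup_tmp.
exists (ereal_inf (f @` [set x | l <= f x])); first by exists [set x | l <= f x].
by apply/ereal_infP => _ [x lx <-].
Qed.

Lemma limf_esup_le (l : \bar R) : (\forall x \near F, f x <= l) ->
  limf_esup f F <= l.
Proof.
move=> lf; rewrite limf_esupE; apply: ge_ereal_inf.
exists (ereal_sup (f @` [set x | f x <= l])); first by exists [set x | f x <= l].
by apply/ereal_supP => _ [x lx <-].
Qed.

(** Two members of a proper filter meet, and the value at a common point lies between the infimum
    over one and the supremum over the other. *)
Lemma limf_einf_le_esup : ProperFilter F -> limf_einf f F <= limf_esup f F.
Proof.
move=> PF; rewrite limf_einfE; apply/ereal_supP => _ [V FV <-].
rewrite limf_esupE; apply/ereal_infP => _ [W FW <-].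
have [x [Vx Wx]] := filter_ex (filterI FV FW).
apply: ge_ereal_inf; exists (f x); first by exists x.
by apply: le_ereal_sup_tmp; exists (f x) => //; exists x.
Qed.

End limf.

Lemma ae_forall_count {d : measure_display} {X : measurableType d}
    {R : realType} (mu : {measure set X -> \bar R}) (I : countType)
    (P : I -> X -> Prop) :
  (forall i, {ae mu, forall x, P i x}) -> {ae mu, forall x, forall i, P i x}.
Proof.
move=> aeP.
have : {ae mu, forall x, forall n, if unpickle n is Some i then P i x else True}.
  apply: ae_foralln => n; case: (unpickle n) => [i|]; first exact: aeP.
  exact: nearW.
by apply: filterS => x Px i; have := Px (pickle i); rewrite pickleK.
Qed.

(** * From hits at the radii [expR (- n%:R)] to the hitting exponent at every small radius *)

Section exponent.
Context {d : measure_display} {R : realType} {X : borelMetricType d R}.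
Variables (T : X -> X) (x0 x : X).

Lemma hitting_timeP r k : hitting_time T x x0 r = Some k ->
  [/\ (0 < k)%N, ball x0 r (iter k T x)
    & forall j, (0 < j)%N -> ball x0 r (iter j T x) -> (k <= j)%N].
Proof.
rewrite /hitting_time; case: pselect => // ex [<-].
case: ex_minnP => m /andP[m0 /asboolP mb] mmin; split => // j j0 jb.
by apply: mmin; rewrite /hits j0; exact/asboolP.
Qed.

Lemma hitting_time_hit_within r N : hit_within T x0 r N x ->
  exists2 k, hitting_time T x x0 r = Some k & (k <= N)%N.
Proof.
move=> /hit_withinP[j /andP[j0 jN] jb].
have ex : exists n, hits T x x0 r n by exists j; rewrite /hits j0; exact/asboolP.
case E : (hitting_time T x x0 r) => [k|]; last first.
  by move: E; rewrite /hitting_time; case: pselect.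
by exists k => //; have [_ _ /(_ _ j0 jb)/leq_trans] := hitting_timeP E; exact.
Qed.

Lemma hit_within_subset r s N : r <= s -> hit_within T x0 r N x ->
  hit_within T x0 s N x.
Proof.
move=> rs /hit_withinP[k kN kb]; apply/hit_withinP; exists k => //.
exact: le_ball kb.
Qed.

(** With n the integer part of [- ln r], a hit of the ball of radius r is also a hit of the larger
    ball of radius [expR (- n%:R)], hence late. *)
Lemma hitting_exponent_ge (b c : R) (K : nat) : 0 <= c -> b < c ->
  ~ hitting_undefined T x x0 ->
  (forall n, (K <= n)%N ->
    ~ hit_within T x0 (expR (- n%:R)) (Num.trunc (expR (c * n%:R))) x) ->
  \forall r \near 0^'+, (b%:E <= hitting_exponent T x x0 r)%E.
Proof.
move=> c0 bc def late.
(* Beyond [c / (c - b)] one has [b * L < c * (L - 1)], which pays for replacing [L] by its integer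
   part. *)
apply: filterS (near_right0_ln (Num.max K%:R (c / (c - b)))) => r [r0].
set L := - ln r; rewrite gt_max => /andP[KL cL].
have L0 : 0 < L by exact: le_lt_trans KL.
rewrite /hitting_exponent -/L lee_fin.
(* Without a hitting time the exponent takes the default value 0, which would spoil a lower bound;
   [def] excludes this. *)
case E : (hitting_time T x x0 r) => [k|]; last by exfalso; apply: def; exists r.
have [k0 kb _] := hitting_timeP E.
have /andP[nL Ln] := truncn_itv (ltW L0); set n := Num.trunc L in nL Ln.
have rE : r = expR (- L) by rewrite opprK lnK.
have kn : expR (c * n%:R) < k%:R.
  rewrite -truncn_lt_nat ?expR_ge0// ltnNge; apply/negP => kn.
  apply: (late n); first by rewrite truncn_ge_nat ltW.
  apply/hit_withinP; exists k; first by rewrite k0.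
  by apply: le_ball kb; rewrite rE ler_expR lerN2.
rewrite /= ler_pdivlMr//; apply: (@le_trans _ _ (c * n%:R)).
  apply: (@le_trans _ _ (c * (L - 1))).
    move: cL; rewrite ltr_pdivrMr ?subr_gt0//; lra.
  by rewrite ler_wpM2l// lerBlDr natr1 ltW.
by rewrite -[leLHS]expRK ler_ln ?posrE ?expR_gt0 ?ltr0n// ltW.
Qed.

(** Here n is the integer part plus one: the ball of radius [expR (- n%:R)] lies inside that of
    radius r, so an early hit of the former is one of the latter. *)
Lemma hitting_exponent_le (b c : R) (K : nat) : 0 <= c -> c < b ->
  (forall n, (K <= n)%N ->
    hit_within T x0 (expR (- n%:R)) (Num.trunc (expR (c * n%:R))) x) ->
  \forall r \near 0^'+, (hitting_exponent T x x0 r <= b%:E)%E.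
Proof.
move=> c0 cb early.
apply: filterS (near_right0_ln (Num.max K%:R (c / (b - c)))) => r [r0].
set L := - ln r; rewrite gt_max => /andP[KL cL].
have L0 : 0 < L by exact: le_lt_trans KL.
rewrite /hitting_exponent -/L lee_fin.
have /andP[nL Ln] := truncn_itv (ltW L0); set n := (Num.trunc L).+1 in Ln.
have rE : r = expR (- L) by rewrite opprK lnK.
have Kn : (K <= n)%N by rewrite leqW// truncn_ge_nat ltW.
have nr : expR (- n%:R) <= r by rewrite rE ler_expR lerN2 ltW.
have [k E kn] := hitting_time_hit_within (hit_within_subset nr (early n Kn)).
have [k0 _ _] := hitting_timeP E.
rewrite E /= ler_pdivrMr//; apply: (@le_trans _ _ (c * n%:R)).
  rewrite -[leRHS]expRK ler_ln ?posrE ?expR_gt0 ?ltr0n//.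
  by rewrite -truncn_ge_nat ?expR_ge0.
apply: (@le_trans _ _ (c * (L + 1))).
  by rewrite ler_wpM2l// -natr1 lerD2r.
by move: cL; rewrite ltr_pdivrMr ?subr_gt0//; lra.
Qed.

Lemma hitting_exponent_ge0 :
  \forall r \near 0^'+, (0 <= hitting_exponent T x x0 r)%E.
Proof.
apply: filterS (near_right0_ln 0) => r [r0 L0].
rewrite lee_fin divr_ge0 ?(ltW L0)//.
case: (odflt _ _) => [|k]; first by rewrite ln0.
by rewrite ln_ge0// ler1n.
Qed.

Lemma hitting_defined (c : R) (K : nat) :
  (forall n, (K <= n)%N ->
    hit_within T x0 (expR (- n%:R)) (Num.trunc (expR (c * n%:R))) x) ->
  ~ hitting_undefined T x x0.
Proof.
move=> early [r r0 E].
pose n := maxn K (Num.trunc (- ln r)).+1.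
have nr : expR (- n%:R) <= r.
  rewrite -[leRHS]lnK ?posrE// ler_expR lerNl ltW//.
  by rewrite (lt_le_trans (truncnS_gt _))// ler_nat leq_maxr.
have [k] := hitting_time_hit_within (hit_within_subset nr (early n (leq_maxl _ _))).
by rewrite E.
Qed.

End exponent.

(** * The local dimension as exponential bounds on the mass of balls *)

Section local_dimension.
Context {d : measure_display} {R : realType} {X : borelMetricType d R}.
Variables (mu : probability X R) (x0 : X).
Hypothesis dim_x0 : has_local_dimension mu x0.

Let ball_mass (n : nat) : R := fine (mu (ball x0 (expR (- n%:R)))).

Let ball_massE n : mu (ball x0 (expR (- n%:R))) = (ball_mass n)%:E.
Proof. by rewrite fineK ?fin_num_measure//; exact: measurable_mball. Qed.

Let ball_mass_ge0 n : 0 <= ball_mass n. Proof. exact: fine_ge0. Qed.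

Lemma dimension_quotient_gt0 n : 0 < ball_mass n ->
  dimension_quotient mu x0 (expR (- n%:R)) = (ln (ball_mass n) / - n%:R)%:E.
Proof.
move=> m0.
by rewrite /dimension_quotient ball_massE lne_EFin// expRK -EFinM.
Qed.

Lemma ball_mass_le (c : R) : (c%:E < local_dimension mu x0)%E ->
  exists N, forall n, (N <= n)%N -> ball_mass n <= expR (- (c * n%:R)).
Proof.
move=> cd.
have [N NP] : exists N, forall n, (N <= n)%N ->
    (c%:E < dimension_quotient mu x0 (expR (- n%:R)))%E.
  apply: (near_right0_expR (P := fun r => (c%:E < dimension_quotient mu x0 r)%E)).
  have /dim_x0 : nbhs (local_dimension mu x0) [set y | (c%:E < y)%E].
    by apply: open_nbhs_nbhs; split => //; exact: open_ereal_gt_ereal.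
  exact.
(* Index 0 is excluded: the radius is 1 there and the quotient divides by its logarithm. *)
exists (maxn N 1) => n; rewrite geq_max => /andP[/NP + n0].
have [<-|m0] := eqVneq 0 (ball_mass n); first by rewrite expR_ge0.
have {}m0 : 0 < ball_mass n by rewrite lt_neqAle m0 ball_mass_ge0.
rewrite dimension_quotient_gt0// lte_fin ltr_ndivlMr ?oppr_lt0 ?ltr0n//.
by rewrite mulrN -ltr_expR lnK ?posrE// => /ltW.
Qed.

Lemma ball_mass_ge (c : R) : (local_dimension mu x0 < c%:E)%E ->
  exists N, forall n, (N <= n)%N -> expR (- (c * n%:R)) <= ball_mass n.
Proof.
move=> dc.
have [N NP] : exists N, forall n, (N <= n)%N ->
    (dimension_quotient mu x0 (expR (- n%:R)) < c%:E)%E.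
  apply: (near_right0_expR (P := fun r => (dimension_quotient mu x0 r < c%:E)%E)).
  have /dim_x0 : nbhs (local_dimension mu x0) [set y | (y < c%:E)%E].
    by apply: open_nbhs_nbhs; split => //; exact: open_ereal_lt_ereal.
  exact.
exists (maxn N 1) => n; rewrite geq_max => /andP[/NP + n0].
(* A null ball would have quotient [+oo], against the bound by [c]. *)
have [m0|m0] := eqVneq 0 (ball_mass n).
  rewrite /dimension_quotient ball_massE -m0 le0_lneNy// expRK.
  by rewrite lt0_mulNye// lte_fin invr_lt0 oppr_lt0 ltr0n.
have {}m0 : 0 < ball_mass n by rewrite lt_neqAle m0 ball_mass_ge0.
rewrite dimension_quotient_gt0// lte_fin ltr_ndivrMr ?oppr_lt0 ?ltr0n//.
by rewrite mulrN -ltr_expR lnK ?posrE// => /ltW.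
Qed.

Lemma local_dimension_ge0 : (0 <= local_dimension mu x0)%E.
Proof.
apply: lime_ge => //; apply: filterS (near_right0_ln 0) => r [r0 L0].
apply: mule_le0; last by rewrite lee_fin invr_le0 -oppr_ge0 ltW.
by rewrite lne_le0 probability_le1//; exact: measurable_mball.
Qed.

End local_dimension.

(** Two reals leave room for a rational strictly between them, also when [y] is [+oo]. *)
Lemma ge0_lte_dense {R : realType} (x y : \bar R) :
  (0 <= x)%E -> (x < y)%E ->
  exists u v : R, [/\ (x < u%:E)%E, u < v & (v%:E < y)%E].
Proof.
case: x y => [x| |//] [y| |]// _ xy; last first.
  by exists (x + 1), (x + 2); split; rewrite ?lte_fin ?ltry//; lra.
move: xy; rewrite lte_fin => xy.
by exists ((2 * x + y) / 3), ((x + 2 * y) / 3); split; rewrite ?lte_fin; lra.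
Qed.

(** * One null set for all rational exponents *)

Section exceptional_sets.
Context {d : measure_display} {R : realType} {X : borelMetricType d R}.
Variables (mu : probability X R) (T : X -> X) (x0 : X).
Hypotheses (mT : measurable_fun [set: X] T) (muT : preserves mu T).
Hypothesis dim_x0 : has_local_dimension mu x0.
Let D := local_dimension mu x0.

Lemma ae_no_early_hit_rat :
  {ae mu, forall x, forall q : rat,
    0 <= ratr q :> R -> ((ratr q : R)%:E < D)%E ->
    exists K, forall n, (K <= n)%N -> ~ hit_within T x0 (expR (- n%:R))
      (Num.trunc (expR (ratr q * n%:R : R))) x}.
Proof.
apply: ae_forall_count => q.
have [q0|_] := boolP (0 <= ratr q :> R); last by apply: nearW.
have [qD|_] := boolP ((ratr q : R)%:E < D)%E; last by apply: nearW.
have [u [v [qu uv vD]]] := ge0_lte_dense (q0 : (0 <= (ratr q)%:E)%E) qD.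
have [N NP] := ball_mass_le dim_x0 vD.
have qv : ratr q < v by rewrite -lte_fin (lt_trans qu).
by apply: filterS (ae_no_early_hit mT muT qv NP).
Qed.

Lemma ae_early_hit_rat : superpolynomial_decay mu T ->
  {ae mu, forall x, forall q : rat, (D < (ratr q : R)%:E)%E ->
    exists K, forall n, (K <= n)%N -> hit_within T x0 (expR (- n%:R))
      (Num.trunc (expR (ratr q * n%:R : R))) x}.
Proof.
move=> decay; apply: ae_forall_count => q.
have [Dq|_] := boolP (D < (ratr q : R)%:E)%E; last by apply: nearW.
have D0 : (0 <= D)%E := local_dimension_ge0 dim_x0.
have [u [v [Du uv vq]]] := ge0_lte_dense D0 Dq.
have [N NP] := ball_mass_ge dim_x0 Du.
have u0 : 0 <= u by rewrite -lee_fin (le_trans D0)// ltW.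
have uq : u < ratr q by rewrite -lte_fin (lt_trans _ vq).
by apply: filterS (ae_early_hit mT muT decay u0 uq NP).
Qed.

End exceptional_sets.

(** * Deterministic bounds on the limits of the exponent at a point off the null set *)

Section indicator_bounds.
Context {d : measure_display} {R : realType} {X : borelMetricType d R}.
Variables (T : X -> X) (x0 x : X) (D : \bar R).

(** If the lower limit [l] were below [D], lateness at a rational q above some u > l would keep the
    exponent eventually above u. Nonnegativity of the exponent gives q >= 0. *)
Lemma limf_einf_hitting_exponent_ge :
  (forall q : rat, 0 <= ratr q :> R -> ((ratr q : R)%:E < D)%E ->
    exists K, forall n, (K <= n)%N -> ~ hit_within T x0 (expR (- n%:R))
      (Num.trunc (expR (ratr q * n%:R : R))) x) ->
  ~ hitting_undefined T x x0 ->
  (D <= limf_einf (hitting_exponent T x x0) 0^'+)%E.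
Proof.
move=> late def; rewrite leNgt; apply/negP.
set l := limf_einf _ _ => lD.
have l0 : (0 <= l)%E by exact/limf_einf_ge/hitting_exponent_ge0.
have [u [v [lu uv vD]]] := ge0_lte_dense l0 lD.
have [q] := rat_in_itvoo uv; rewrite in_itv/= => /andP[uq qv].
have q0 : 0 <= ratr q :> R.
  by rewrite -lee_fin (le_trans l0)// (le_trans (ltW lu))// lee_fin ltW.
have [|K KP] := late q q0; first by apply: lt_trans vD; rewrite lte_fin.
move: lu; rewrite ltNge => /negP; apply.
exact: (limf_einf_ge (hitting_exponent_ge q0 uq def KP)).
Qed.

(** Finiteness of [D] supplies rationals above it: any of them shows that all balls are hit, and
    those close to [D] bound the upper limit. *)
Lemma limf_esup_hitting_exponent_le : (0 <= D)%E ->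
  (forall q : rat, (D < (ratr q : R)%:E)%E ->
    exists K, forall n, (K <= n)%N -> hit_within T x0 (expR (- n%:R))
      (Num.trunc (expR (ratr q * n%:R : R))) x) ->
  (D < +oo)%E ->
  ~ hitting_undefined T x x0 /\
  (limf_esup (hitting_exponent T x x0) 0^'+ <= D)%E.
Proof.
case: D => [e|//|//] e0 early _.
have {}early b : e < b -> exists2 c : R, 0 <= c < b &
    exists K, forall n, (K <= n)%N ->
      hit_within T x0 (expR (- n%:R)) (Num.trunc (expR (c * n%:R))) x.
  move=> eb; have [q] := rat_in_itvoo eb; rewrite in_itv/= => /andP[eq qb].
  have [|K KP] := early q; first by rewrite lte_fin.
  by exists (ratr q); [rewrite qb andbT ltW// (le_lt_trans _ eq)|exists K].
split.
  have [|c _ [K]] := early (e + 1); first by rewrite ltrDl.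
  exact: hitting_defined.
apply/lee_addgt0Pr => s s0; rewrite -EFinD.
have [|c /andP[c0 ce] [K KP]] := early (e + s); first by rewrite ltrDl.
exact: (limf_esup_le (hitting_exponent_le c0 ce KP)).
Qed.

End indicator_bounds.

(** * Almost sure equality of both indicators with the local dimension *)

Theorem theorem4 (d : measure_display) (R : realType) (X : borelMetricType d R)
    (sepX : separable_space X) (mu : probability X R) (T : X -> X)
    (mT : measurable_fun [set: X] T) (muT : preserves mu T)
    (decay : superpolynomial_decay mu T)
    (x0 : X) (dim_x0 : has_local_dimension mu x0) :
  {ae mu, forall x,
    upper_hitting_indicator T x x0 = local_dimension mu x0 /\
    lower_hitting_indicator T x x0 = local_dimension mu x0}.
Proof.
set D := local_dimension mu x0.
have D0 : (0 <= D)%E := local_dimension_ge0 dim_x0.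
apply: filterS2 (ae_no_early_hit_rat mT muT dim_x0)
  (ae_early_hit_rat mT muT dim_x0 decay) => x late early.
have supD := limf_esup_hitting_exponent_le D0 early.
rewrite /upper_hitting_indicator /lower_hitting_indicator.
case: pselect => [und|def].
  (* Both indicators are [+oo] by convention; a finite [D] would make all hitting times defined. *)
  suff -> : D = +oo%E by [].
  by apply/eqP; rewrite eq_le leey leNgt; apply/negP => /supD[].
have Dinf := limf_einf_hitting_exponent_ge late def.
have infsup : (limf_einf (hitting_exponent T x x0) 0^'+ <=
    limf_esup (hitting_exponent T x x0) 0^'+)%E by exact: limf_einf_le_esup.
have {}supD : (limf_esup (hitting_exponent T x x0) 0^'+ <= D)%E.
  have [/supD[]//|] := ltP D +oo%E.
  by rewrite leye_eq => /eqP ->; rewrite leey.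
split; apply/eqP; rewrite eq_le.
  by rewrite supD (le_trans Dinf).
by rewrite (le_trans infsup supD) Dinf.
Qed.
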